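(* Let $(P_0,P_1)$ be an equitable $2$-partition of the halved $n$-cube $\frac12 H(n)$ with quotient matrix $\begin{pmatrix} a & b\\ c & d\end{pmatrix}$, and suppose that $P_1$ is partitioned into $s$-faces, where $s=\sqrt{2d+n-2b}$. Then there exists an equitable $2$-partition of $\frac12 H(2n)$ with quotient matrix $\begin{pmatrix} 4a+n+2b & 2b\\ 4c+2b & 4d+n-2b\end{pmatrix}$.
   Context: The halved $m$-cube $\frac12 H(m)$ is the graph on the binary words of length $m$ with an even number of ones, two words adjacent iff they differ in exactly two positions. An $s$-face of $\frac12 H(n)$ is the set of $2^{s-1}$ vertices having prescribed values in some $n-s$ fixed coordinates (the other $s$ coordinates being free). An equitable $2$-partition is an ordered partition $(C_0,C_1)$ of the vertex set such that the number of neighbors in $C_j$ of any vertex of $C_i$ is a constant $S_{ij}$; $S=(S_{ij})$ is the quotient matrix. *)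

(* Defs.v *)
From HB Require Import structures.
From mathcomp Require Import all_boot all_order all_algebra all_field.

Set Implicit Arguments.
Unset Strict Implicit.
Unset Printing Implicit Defensive.

Import Order.TTheory GRing.Theory Num.Theory.
Local Open Scope ring_scope.

Definition word (m : nat) := {ffun 'I_m -> bool}.

Definition even_word (m : nat) (x : word m) : bool := ~~ odd #|[set i | x i]|.

Definition halved_cube (m : nat) : finType := {x : word m | even_word x}.

Definition halved_adj (m : nat) : rel (halved_cube m) :=
  fun x y => #|[set i | val x i != val y i]| == 2%N.

(* [T] is the set of free coordinates and [p] prescribes the values on the
   others; [p] need not be even, and its values on [T] are irrelevant.
   [0 < s] is what makes an [s]-face have [2 ^ (s - 1)] vertices: fixing all
   coordinates would leave one vertex or none. *)
Definition is_face (n s : nat) (F : {set halved_cube n}) : Prop :=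
  (0 < s)%N /\
  exists (T : {set 'I_n}) (p : word n),
    #|T| = s /\
    F = [set x : halved_cube n | [forall i, (i \notin T) ==> (val x i == p i)]].

Definition partitioned_into_faces (n s : nat) (A : {set halved_cube n}) : Prop :=
  exists Q : {set {set halved_cube n}},
    partition Q A /\ forall F, F \in Q -> is_face s F.

(* The cells are nonempty, so the quotient matrix is determined by them.  Its
   entries are typed in [int] only so that differences of entries are not
   truncated. *)
Definition equitable_partition (V : finType) (e : rel V) (k : nat)
    (C : 'I_k -> {set V}) (S : 'M[int]_k) : Prop :=
  [/\ forall i, C i != set0,
      forall i j, i != j -> [disjoint C i & C j],
      \bigcup_i C i = [set: V] &
      forall i j v, v \in C i -> #|[set w in C j | e v w]|%:Z = S i j].

Definition mx22 (a b c d : int) : 'M[int]_2 :=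
  \matrix_(i, j) if i == 0 then (if j == 0 then a else b)
                 else (if j == 0 then c else d).

(* Main.v *)
(** Folding a word (x, y) of length 2n to x + y pulls P back to an equitable
partition with quotient matrix 4S + nI, where S is the given matrix.  Each
preimage of P_1 is then halved by a sign: over a face with free coordinates T,
(x, y) gets (-1)^(sum of x_i, i not in T).  Extended by 0 over P_0, this sign
is an eigenfunction of the halved 2n-cube.  Two words differing by a transfer
of one unit from x_i to y_i, i not in T, have opposite signs, so the
contributions of all other faces cancel; inside the face there remain
4 binom(s, 2) + s - (n - s) = 2 s^2 - n.  The hypothesis on s says that this
eigenvalue is 4d + n - 4b, which is what makes the negative half of the
preimage of P_1 see as many positive words as the preimage of P_0 does.  The
new P_1 is the positive half. *)

Require Import Defs.
From HB Require Import structures.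
From mathcomp Require Import all_boot all_order all_algebra all_field.
From mathcomp Require Import ring zify.

Set Implicit Arguments.
Unset Strict Implicit.
Unset Printing Implicit Defensive.

Import Order.TTheory GRing.Theory Num.Theory.
Local Open Scope ring_scope.

(** * Coordinate flips and parity *)

Definition flip (m : nat) (k : 'I_m) (u : word m) : word m :=
  [ffun l => u l (+) (l == k)].

Lemma flipC (m : nat) (k l : 'I_m) (u : word m) :
  flip k (flip l u) = flip l (flip k u).
Proof. by apply/ffunP=> i; rewrite !ffunE -!addbA [X in _ (+) X]addbC. Qed.

Lemma flipK (m : nat) (k : 'I_m) : involutive (flip k).
Proof. by move=> u; apply/ffunP=> i; rewrite !ffunE -addbA addbb addbF. Qed.

Lemma flip2K (m : nat) (k l : 'I_m) (u : word m) :
  flip k (flip l (flip k (flip l u))) = u.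
Proof. by rewrite (flipC l k) !flipK. Qed.

Definition parity (m : nat) (u : word m) : bool := \big[addb/false]_i u i.

Lemma even_wordE (m : nat) (u : word m) : even_word u = ~~ parity u.
Proof.
rewrite /even_word /parity -sum1_card (big_morph odd oddD (erefl _)).
rewrite (eq_bigl u); last by move=> i; rewrite inE.
by rewrite big_mkcond; congr (~~ _); apply: eq_bigr => i _; case: (u i).
Qed.

Lemma parity_flip (m : nat) (k : 'I_m) (u : word m) :
  parity (flip k u) = ~~ parity u.
Proof.
rewrite /parity.
under eq_bigr do rewrite ffunE.
rewrite big_split /= -[LHS]addbC -addTb; congr (_ (+) _).
by rewrite (bigD1 k) //= eqxx big1 // => i /negbTE.
Qed.

Lemma even_word_flip2 (m : nat) (k l : 'I_m) (u : word m) :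
  even_word (flip k (flip l u)) = even_word u.
Proof. by rewrite !even_wordE !parity_flip negbK. Qed.

(** * Neighbour counts as sums over ordered pairs of flips *)

(** A word at distance two from [u] is reached by the two orderings of the pair of coordinates where
    it differs. Hence the factor 2 in [adj_sum]. *)
Lemma flip2_pairs (m : nat) (u w : word m) :
  #|[set p : 'I_m * 'I_m | (p.2 != p.1) && (flip p.1 (flip p.2 u) == w)]|
  = (#|[set i | u i != w i]| == 2%N).*2.
Proof.
have dif k l : l != k -> flip k (flip l u) = w ->
    [set i | u i != w i] = [set k; l].
  move=> nkl <-; apply/setP=> i; rewrite !inE !ffunE.
  case: (eqVneq i k) => [->|_]; first by rewrite [k == l]eq_sym (negbTE nkl); case: (u k).
  by case: (eqVneq i l) => [->|_]; [case: (u l) | case: (u i)].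
have [two|ne2] := boolP (_ == 2%N); last first.
  apply: eq_card0 => -[k l]; rewrite !inE /=; apply/negP=> /andP[nkl /eqP E].
  by move: ne2; rewrite (dif _ _ nkl E) cards2 [k == l]eq_sym nkl.
have /cards2P[k [l [nkl Ekl]]] := two.
have E : flip k (flip l u) = w.
  apply/ffunP=> i; move/setP/(_ i): Ekl; rewrite !inE !ffunE.
  have : ~~ ((i == k) && (i == l)).
    by apply/negP=> /andP[/eqP-> /eqP]; apply/eqP.
  by case: (i == k); case: (i == l); case: (u i); case: (w i).
have -> : [set p : 'I_m * 'I_m | (p.2 != p.1) && (flip p.1 (flip p.2 u) == w)]
   = [set (k, l); (l, k)].
  apply/setP=> -[k' l']; rewrite !inE /=; apply/idP/idP.
    move=> /andP[n' /eqP E']; move: (dif _ _ n' E'); rewrite Ekl => /setP S.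
    move: (S k') (S l'); rewrite !inE !eqxx !orbT !xpair_eqE /=.
    case/orP=> /eqP ? /orP[] /eqP ?; subst; rewrite ?eqxx ?orbT //;
      by rewrite eqxx in n'.
  case/orP=> /eqP[-> ->]; first by rewrite [l == k]eq_sym nkl E eqxx.
  by rewrite nkl flipC E eqxx.
by rewrite cards2 xpair_eqE negb_and nkl.
Qed.

Lemma adj_sum (m : nat) (x : halved_cube m) (A : {set halved_cube m}) :
  2 * #|[set y in A | halved_adj x y]|%:Z
  = \sum_k \sum_(l | l != k)
      (flip k (flip l (val x)) \in [set val y | y in A])%:R.
Proof.
rewrite pair_big_dep /=.
(* Group the pairs of coordinates by the word they lead to. *)
rewrite (partition_big (fun p => flip p.1 (flip p.2 (val x))) predT) //=.
rewrite -sum1_card -natz natr_sum mulr_sumr.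
rewrite [RHS](bigID (mem [set val y | y in A])) /= [X in _ = _ + X]big1 ?addr0; last first.
  by move=> w wA; rewrite big1 // => p /andP[_ /eqP->]; rewrite (negbTE wA).
rewrite big_imset /=; last by move=> y z _ _; apply: val_inj.
rewrite [LHS](eq_bigl (fun y => (y \in A) && halved_adj x y)); last first.
  by move=> y; rewrite inE.
rewrite big_mkcondr; apply: eq_bigr => y yA.
rewrite (eq_bigr (fun=> 1)); last first.
  by move=> p /andP[_ /eqP->]; rewrite imset_f.
have := flip2_pairs (val x) (val y); rewrite cardsE sumr_const => ->.
by rewrite /halved_adj; case: (_ == 2%N).
Qed.

Lemma sum_offdiag_const (I : finType) (A : {set I}) (r : int) :
  \sum_i \sum_(j | j != i) r * ((i \in A) && (j \in A))%:R
  = r * (#|A|%:Z * (#|A|%:Z - 1)).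
Proof.
have row i : \sum_(j | j != i) r * ((i \in A) && (j \in A))%:R
    = (r * (#|A|%:Z - 1)) * (i \in A)%:R.
  case: (boolP (i \in A)) => iA /=; last by rewrite big1 ?mulr0 // => j _; rewrite mulr0.
  rewrite -mulr_sumr mulr1; congr (_ * _).
  rewrite (cardD1 i) iA -sum1_card /= -natz natrD natr_sum addrC addKr.
  rewrite big_mkcond [RHS]big_mkcond; apply: eq_bigr => j _.
  by rewrite !inE; case: (j != i); case: (j \in A).
rewrite (eq_bigr _ (fun i _ => row i)) -mulr_sumr.
rewrite -mulrA; congr (_ * _); rewrite mulrC; congr (_ * _).
rewrite -sum1_card -natz natr_sum [RHS]big_mkcond.
by apply: eq_bigr => j _; case: (j \in A).
Qed.

Lemma big_bool_pair (R : Type) (idx : R) (op : Monoid.com_law idx)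
    (I : finType) (G : bool * I -> R) :
  \big[op/idx]_p G p = \big[op/idx]_i \big[op/idx]_al G (al, i).
Proof.
rewrite exchange_big pair_bigA /=.
by apply: eq_bigr => -[al i].
Qed.

(** Distinct pairs either share the index in [I], and then their booleans are opposite, or have
    distinct indices and arbitrary booleans. *)
Lemma sum_offdiag_bool (I : finType) (F : bool * I -> bool * I -> int) :
  \sum_p \sum_(q | q != p) F p q
  = \sum_i \sum_al F (al, i) (~~ al, i)
    + \sum_i \sum_(j | j != i) \sum_al \sum_be F (al, i) (be, j).
Proof.
rewrite big_bool_pair -big_split; apply: eq_bigr => i _ /=.
rewrite [X in _ = _ + X]exchange_big /= -big_split.
apply: eq_bigr => al _ /=.
rewrite big_mkcond big_bool_pair (bigD1 i) //=; congr (_ + _).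
  by rewrite big_bool /= !xpair_eqE eqxx; case: al => /=; rewrite ?addr0 ?add0r.
apply: eq_bigr => j nji; apply: eq_bigr => be _.
by rewrite xpair_eqE (negbTE nji) andbF.
Qed.

Lemma mem_val_imset (m : nat) (p : pred (word m)) (w : word m) :
  (w \in [set val y | y in [set y : halved_cube m | p (val y)]])
  = even_word w && p w.
Proof.
apply/imsetP/andP=> [[y + ->]|[ew pw]]; first by rewrite inE => ->; split=> //; exact: valP.
by exists (Sub w ew); rewrite ?inE SubK.
Qed.

(** Every vertex has degree m(m - 1)/2, so counting neighbours in one cell of a 2-partition
    determines the count in the other. *)
Lemma adj_degree (m : nat) (x : halved_cube m) (A : {set halved_cube m}) :
  2 * (#|[set y in ~: A | halved_adj x y]|%:Z
       + #|[set y in A | halved_adj x y]|%:Z) = m%:Z * (m%:Z - 1).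
Proof.
rewrite mulrDr !adj_sum -big_split /=.
have := sum_offdiag_const [set: 'I_m] 1; rewrite cardsT card_ord mul1r => <-.
apply: eq_bigr => k _; rewrite -big_split; apply: eq_bigr => l _ /=.
have ev : even_word (flip k (flip l (val x))) by rewrite even_word_flip2; apply: valP.
have <- : val (Sub _ ev : halved_cube m) = flip k (flip l (val x)) by rewrite SubK.
by rewrite !(mem_imset _ _ val_inj) !inE; case: (_ \in A).
Qed.

(** * Words of length 2n and their folding *)

Lemma card_dbl (n : nat) : #|{: bool * 'I_n}| = (2 * n)%N.
Proof. by rewrite card_prod card_bool card_ord. Qed.

(** [false] marks the coordinates of x and [true] those of y. The order in which they are laid out
    is immaterial; only bijectivity is used. *)
Definition dbl (n : nat) (p : bool * 'I_n) : 'I_(2 * n) :=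
  cast_ord (card_dbl n) (enum_rank p).

Lemma dbl_bij (n : nat) : bijective (@dbl n).
Proof.
exists (fun k => enum_val (cast_ord (esym (card_dbl n)) k)) => [p|k].
  by rewrite cast_ordK enum_rankK.
by rewrite /dbl enum_valK cast_ordKV.
Qed.

Definition fold (n : nat) (u : word (2 * n)) : word n :=
  [ffun i => u (dbl (false, i)) (+) u (dbl (true, i))].

Lemma fold_flip (n : nat) (al : bool) (i : 'I_n) (u : word (2 * n)) :
  fold (flip (dbl (al, i)) u) = flip i (fold u).
Proof.
apply/ffunP=> j; rewrite !ffunE !(inj_eq (bij_inj (@dbl_bij n))) !xpair_eqE.
by case: al; rewrite /= ?addbF; case: (u _); case: (u _); case: (j == i).
Qed.

Lemma parity_fold (n : nat) (u : word (2 * n)) : parity (fold u) = parity u.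
Proof.
rewrite /parity [RHS](reindex (@dbl n)) /=; last exact/onW_bij/dbl_bij.
rewrite big_bool_pair; apply: eq_bigr => i _.
by rewrite ffunE big_bool addbC.
Qed.

Lemma even_word_fold (n : nat) (u : word (2 * n)) :
  even_word (fold u) = even_word u.
Proof. by rewrite !even_wordE parity_fold. Qed.

(** * The sign and its eigenvalue *)

Definition twist (n : nat) (T : {set 'I_n}) (u : word (2 * n)) : bool :=
  \big[addb/false]_(i in ~: T) u (dbl (false, i)).

Lemma twist_flip (n : nat) (T : {set 'I_n}) al i (u : word (2 * n)) :
  twist T (flip (dbl (al, i)) u) = twist T u (+) (~~ al && (i \notin T)).
Proof.
rewrite /twist.
under eq_bigr do rewrite ffunE.
rewrite big_split /=; congr (_ (+) _).
under eq_bigr do rewrite (inj_eq (bij_inj (@dbl_bij n))) xpair_eqE.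
case: al => /=; first by rewrite big1.
case: (boolP (i \in T)) => iT /=.
  by rewrite big1 // => j; rewrite inE; apply: contraNF => /eqP->.
by rewrite (bigD1 i) ?inE //= eqxx big1 // => j /andP[_ /negbTE].
Qed.

(** The first sum collects the transfers between x_i and y_i, which fix the folded word; in the
    second each pair (i, j) of folded coordinates has four lifts. *)
Lemma sum_flip2_dbl (n : nat) (phi : word (2 * n) -> int) (u : word (2 * n)) :
  \sum_k \sum_(l | l != k) phi (flip k (flip l u))
  = \sum_i \sum_al phi (flip (dbl (al, i)) (flip (dbl (~~ al, i)) u))
    + \sum_i \sum_(j | j != i)
        \sum_al \sum_be phi (flip (dbl (al, i)) (flip (dbl (be, j)) u)).
Proof.
rewrite (reindex (@dbl n)) /=; last exact/onW_bij/dbl_bij.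
rewrite -(sum_offdiag_bool (fun p q => phi (flip (dbl p) (flip (dbl q) u)))).
apply: eq_bigr => p _.
rewrite (reindex (@dbl n)) /=; last exact/onW_bij/dbl_bij.
by apply: eq_bigl => q; rewrite (inj_eq (bij_inj (@dbl_bij n))).
Qed.

Lemma fold_flip2_sum (n : nat) (B : {set word n}) (u : word (2 * n)) :
  \sum_k \sum_(l | l != k) (fold (flip k (flip l u)) \in B)%:R
  = 2 * n%:Z * (fold u \in B)%:R
    + 4 * \sum_i \sum_(j | j != i) (flip i (flip j (fold u)) \in B)%:R :> int.
Proof.
rewrite (sum_flip2_dbl (fun w => (fold w \in B)%:R)); congr (_ + _).
  under eq_bigr do under eq_bigr do rewrite !fold_flip flipK.
  by rewrite sumr_const sumr_const card_bool card_ord -mulr_natl -mulr_natl natz; ring.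
rewrite mulr_sumr; apply: eq_bigr => i _; rewrite mulr_sumr; apply: eq_bigr => j _.
under eq_bigr do under eq_bigr do rewrite !fold_flip.
by rewrite !sumr_const card_bool; ring.
Qed.

(* [Tf z] is the set of free coordinates of the face containing [z]. *)
Definition signed (n : nat) (B : {set word n}) (Tf : word n -> {set 'I_n})
    (u : word (2 * n)) : int :=
  (fold u \in B)%:R * (-1) ^+ twist (Tf (fold u)) u.

(** Transfers contribute 2(2s - n) and pairs of free directions 4s(s - 1), in total twice the
    eigenvalue, because pairs are ordered. [stabT] is all that is needed of the faces: moving along
    two free directions stays in the same face. *)
Lemma signed_flip2_sum (n s : nat) (B : {set word n}) (Tf : word n -> {set 'I_n})
    (cardT : forall z, z \in B -> #|Tf z| = s)
    (stabT : forall z i j, z \in B -> i \in Tf z -> j \in Tf z ->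
       flip i (flip j z) \in B /\ Tf (flip i (flip j z)) = Tf z)
    (u : word (2 * n)) :
  \sum_k \sum_(l | l != k) signed B Tf (flip k (flip l u))
  = 2 * (2 * s%:Z ^+ 2 - n%:Z) * signed B Tf u.
Proof.
set z := fold u.
(* Exactly one of the two flips hits x, so the sign changes exactly when [i] is not free. *)
have same i al : signed B Tf (flip (dbl (al, i)) (flip (dbl (~~ al, i)) u))
    = signed B Tf u * (2 * (i \in Tf z)%:R - 1).
  rewrite /signed !fold_flip flipK !twist_flip -/z.
  by case: al; case: (i \in Tf z); case: (twist _ u); case: (z \in B).
have cross i j : j != i ->
    \sum_al \sum_be signed B Tf (flip (dbl (al, i)) (flip (dbl (be, j)) u))
    = 4 * signed B Tf u * ((i \in Tf z) && (j \in Tf z))%:R.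
  move=> nji; rewrite !big_bool /signed !fold_flip !twist_flip -/z /= !addbF.
  set z' := flip i (flip j z).
  have z'K : flip i (flip j z') = z by rewrite flip2K.
  (* If both directions are free at [z'], then [z] lies in the same face and the four lifts all have
     the sign of [u]. Otherwise they are not both free at [z] either, and the lifts cancel along a
     direction fixed at [z']. *)
  case: (boolP ((z' \in B) && ((i \in Tf z') && (j \in Tf z')))) => [|out].
    move=> /and3P[z'B iT jT]; have [zB TE] := stabT _ _ _ z'B iT jT.
    rewrite z'K in zB TE; rewrite TE iT jT zB z'B /= !addbF; ring.
  rewrite -[RHS]mulrA.
  have -> : (z \in B)%:R * (-1) ^+ twist (Tf z) u
      * ((i \in Tf z) && (j \in Tf z))%:R = 0 :> int.
    case: (boolP (z \in B)) => zB; rewrite ?mul0r //.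
    case: (boolP (i \in Tf z)) => iT; rewrite ?mulr0 //.
    case: (boolP (j \in Tf z)) => jT; rewrite ?mulr0 //.
    have [z'B TE] := stabT _ _ _ zB iT jT.
    by move: out; rewrite -/z' in z'B TE *; rewrite z'B TE iT jT.
  rewrite mulr0 -/z'.
  move: out; case: (z' \in B) => /=; last by move=> _; rewrite !mul0r !addr0.
  by case: (i \in Tf z'); case: (j \in Tf z'); case: (twist _ u).
rewrite (sum_flip2_dbl (signed B Tf)).
under eq_bigr do under eq_bigr do rewrite same.
under [X in _ + X]eq_bigr do under eq_bigr do rewrite cross //.
rewrite sum_offdiag_const.
under eq_bigr do rewrite sumr_const card_bool.
rewrite sumrMnl -mulr_sumr sumrB -mulr_sumr sumr_const card_ord.
have -> : \sum_i (i \in Tf z)%:R = #|Tf z|%:Z.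
  rewrite -sum1_card -natz natr_sum [RHS]big_mkcond.
  by apply: eq_bigr => j _; case: (j \in Tf z).
rewrite natz /signed -/z; case: (boolP (z \in B)) => zB; last by rewrite /=; ring.
by rewrite cardT //; ring.
Qed.

(** * Free directions of a partition into faces *)

Lemma face_directions (n s : nat) (A : {set halved_cube n}) :
  partitioned_into_faces s A ->
  exists Tf : word n -> {set 'I_n},
    (forall z, z \in [set val x | x in A] -> #|Tf z| = s) /\
    (forall z i j, z \in [set val x | x in A] -> i \in Tf z -> j \in Tf z ->
       flip i (flip j z) \in [set val x | x in A]
       /\ Tf (flip i (flip j z)) = Tf z).
Proof.
move=> [Q [/and3P[/eqP covQ tiQ _] face]].
have /fin_all_exists[T hT] : forall F : {set halved_cube n},
    exists TF : {set 'I_n}, F \in Q -> #|TF| = s /\ exists p : word n,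
      F = [set x : halved_cube n | [forall i, (i \notin TF) ==> (val x i == p i)]].
  move=> F.
  case: (boolP (F \in Q)) => [/face[_ [TF [p [cT E]]]]|_]; last by exists set0.
  by exists TF => _; split=> //; exists p.
(* Odd words are not vertices; they get the dummy value [set0]. *)
pose Tf (z : word n) :=
  if insub z is Some x then T (pblock Q (x : halved_cube n)) else set0.
have TfE (x : halved_cube n) : Tf (val x) = T (pblock Q x) by rewrite /Tf valK.
have block x : x \in A -> pblock Q x \in Q by move=> xA; rewrite pblock_mem ?covQ.
exists Tf; split=> [_ /imsetP[x xA ->]|_ i j /imsetP[x xA ->]].
  by rewrite TfE; have [] := hT _ (block x xA).
rewrite TfE => iT jT.
have ev : even_word (flip i (flip j (val x))) by rewrite even_word_flip2; apply: valP.
pose y : halved_cube n := Sub _ ev.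
have yE : val y = flip i (flip j (val x)) by rewrite SubK.
have [_ [p E]] := hT _ (block x xA).
(* Flipping free coordinates keeps all prescribed values. *)
have yF : y \in pblock Q x.
  have : x \in pblock Q x by rewrite mem_pblock covQ.
  rewrite E !inE => /forallP H; apply/forallP=> k; apply/implyP=> kT.
  rewrite yE !ffunE; have /eqP <- := implyP (H k) kT.
  have /negbTE-> : k != i by apply: contraNneq kT => ->.
  have /negbTE-> : k != j by apply: contraNneq kT => ->.
  by rewrite !addbF.
rewrite -yE TfE; split; last by rewrite (def_pblock tiQ (block x xA) yF).
by apply: imset_f; rewrite -covQ; apply/bigcupP; exists (pblock Q x) => //; apply: block.
Qed.

(** * Assembly of the partition of the halved 2n-cube *)

Theorem theorem3 (n s : nat) (a b c d : int)
    (P : 'I_2 -> {set halved_cube n})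
    (hP : equitable_partition (@halved_adj n) P (mx22 a b c d))
    (hs : s%:R = sqrtC (2 * d + n%:Z - 2 * b)%:~R :> algC)
    (hfaces : partitioned_into_faces s (P 1)) :
  exists C : 'I_2 -> {set halved_cube (2 * n)},
    equitable_partition (@halved_adj (2 * n)) C
      (mx22 (4 * a + n%:Z + 2 * b) (2 * b)
            (4 * c + 2 * b) (4 * d + n%:Z - 2 * b)).
Proof.
have [neP disP covP eqP'] := hP.
have P0E : P 0 = ~: P 1.
  apply/setP=> x; rewrite inE; case: (boolP (x \in P 1)) => xP /=.
    by rewrite (disjointFl (disP 0 1 isT) xP).
  have : x \in \bigcup_i P i by rewrite covP inE.
  case/bigcupP=> i _; case: (eqVneq i 1) => [->|]; first by rewrite (negbTE xP).
  by case: i => -[|[|//]] // lt _; rewrite (_ : Ordinal lt = 0) //; apply: val_inj.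
(* Squaring undoes the root in [algC]; the integers embed injectively there, so the equation
   descends to [int]. *)
have s2 : s%:Z ^+ 2 = 2 * d + n%:Z - 2 * b.
  by apply: (@intr_inj algC); rewrite -[RHS]sqrtCK -hs rmorphXn.
have deg i x : x \in P i -> 2 * (mx22 a b c d i 0 + mx22 a b c d i 1) = n%:Z * (n%:Z - 1).
  by move=> xP; rewrite -!(eqP' _ _ _ xP) P0E adj_degree.
have [x0 x0P] := set0Pn _ (neP 0).
have [x1 x1P] := set0Pn _ (neP 1).
have ab : 2 * (a + b) = n%:Z * (n%:Z - 1) by have := deg _ _ x0P; rewrite !mxE.
have cd : 2 * (c + d) = n%:Z * (n%:Z - 1) by have := deg _ _ x1P; rewrite !mxE.
have [Tf [cardT stabT]] := face_directions hfaces.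
set B := [set val x | x in P 1] in cardT stabT.
(* A false [twist] is the sign +1. *)
pose half (w : word (2 * n)) := (fold w \in B) && ~~ twist (Tf (fold w)) w.
pose C1 := [set u : halved_cube (2 * n) | half (val u)].
have base (u : halved_cube (2 * n)) :
    \sum_i \sum_(j | j != i) (flip i (flip j (fold (val u))) \in B)%:R
    = 2 * (if fold (val u) \in B then d else b).
  have ev : even_word (fold (val u)) by rewrite even_word_fold; apply: valP.
  pose x : halved_cube n := Sub _ ev.
  have xE : val x = fold (val u) by rewrite SubK.
  rewrite -xE -adj_sum (mem_imset _ _ val_inj); congr (_ * _).
  case: (boolP (x \in P 1)) => xP; first by rewrite (eqP' _ _ _ xP) !mxE.
  by rewrite (eqP' 0) ?P0E ?inE // !mxE.
(* Twice the indicator of [half] is the indicator of the preimage of [B] plus [signed]; with the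
   factor 2 of [adj_sum] this gives 4. *)
have count (u : halved_cube (2 * n)) :
    4 * #|[set w in C1 | halved_adj u w]|%:Z
    = 2 * n%:Z * (fold (val u) \in B)%:R
      + 8 * (if fold (val u) \in B then d else b)
      + 2 * (2 * s%:Z ^+ 2 - n%:Z) * signed B Tf (val u).
  rewrite -(signed_flip2_sum cardT stabT).
  have -> : 8 * (if fold (val u) \in B then d else b)
     = 4 * (2 * (if fold (val u) \in B then d else b)) by ring.
  rewrite -base -fold_flip2_sum -big_split /=.
  rewrite -[4]/(2 * 2 : int) -mulrA adj_sum mulr_sumr; apply: eq_bigr => k _.
  rewrite mulr_sumr -big_split; apply: eq_bigr => l _ /=.
  rewrite mem_val_imset even_word_flip2 (valP u) /half /signed.
  by case: (_ \in B); case: (twist _ _).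
(* By [s2], the count 2d + s^2 on the positive half is 4d + n - 2b, and n + 2d - s^2 on the negative
   half is 2b, the same as over [P 0]. *)
have count1 (u : halved_cube (2 * n)) : #|[set w in C1 | halved_adj u w]|%:Z
    = if u \in C1 then 4 * d + n%:Z - 2 * b else 2 * b.
  have := count u; rewrite inE /half /signed s2.
  by case: (_ \in B); case: (twist _ _) => /=; rewrite ?expr1 ?expr0; lia.
exists (fun i => if i == 0 then ~: C1 else C1); split.
(* Both cells are nonempty: a vertex [x] lifts to (0, x), which has sign +1. *)
- have e (x : halved_cube n) : exists u : halved_cube (2 * n),
      fold (val u) = val x /\ twist (Tf (val x)) (val u) = false.
    pose w : word (2 * n) := [ffun k => [exists i, (k == dbl (true, i)) && val x i]].
    have w0 i : w (dbl (false, i)) = false.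
      rewrite ffunE; apply/existsP=> -[j /andP[/eqP /(bij_inj (@dbl_bij n))]].
      by case.
    have fw : fold w = val x.
      apply/ffunP=> i; rewrite ffunE w0 /= ffunE; apply/existsP/idP.
        by case=> j /andP[/eqP/(bij_inj (@dbl_bij n)) [ij] xj]; rewrite ij.
      by exists i; rewrite eqxx.
    have ev : even_word w by rewrite -even_word_fold fw; apply: valP.
    exists (Sub w ev); rewrite SubK fw; split=> //.
    by rewrite /twist big1.
  move=> i; case: ifP => _; apply/set0Pn.
    have [u [fu _]] := e x0; exists u; rewrite !inE /half fu (mem_imset _ _ val_inj).
    by move: x0P; rewrite P0E inE => /negbTE->.
  have [u [fu tu]] := e x1; exists u.
  by rewrite inE /half fu (mem_imset _ _ val_inj) x1P tu.
- move=> i j; case: (eqVneq i 0) => [->|i0]; case: (eqVneq j 0) => [j0|j0] //=.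
  + by rewrite disjoints_subset.
  + by rewrite disjoint_sym disjoints_subset.
  + by move: i0 j0; case: i => -[|[|]] // ? ; case: j => -[|[|]] // ?.
- apply/setP=> u; rewrite inE; apply/bigcupP.
  case: (boolP (u \in C1)) => uC; first by exists 1.
  by exists 0 => //=; rewrite inE.
- move=> i j v vi.
  have vC : (v \in C1) = (i != 0).
    by move: vi; case: ifP => // _; rewrite inE => /negbTE.
  have := count1 v; rewrite vC !mxE => N1.
  (* The first column follows from the degree n(2n - 1), with a + b and c + d both equal to n(n -
     1)/2 by [ab] and [cd]. *)
  have := adj_degree v C1; rewrite PoszM => N.
  case: (eqVneq j 0) => _; last by rewrite N1; case: (eqVneq i 0).
  by move: N; rewrite N1; case: (eqVneq i 0) => _ /=; nia.
Qed.
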